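(* Let $2 \le r \le n$ and let $B \in \mathbb{G}_n^r$ be a non-zero $r$-vector. Then $B$ is an $r$-blade if and only if the Plücker relations $$(A\cdot B)\wedge B = 0 \quad \text{for all } (r-1)\text{-vectors } A \in \mathbb{G}_n^{r-1}$$ are satisfied. Moreover, when the Plücker relations are satisfied, there exist distinct coordinate vectors $e_{j_1},\dots,e_{j_r}$ and coordinate $(r-1)$-blades $e_{K_{j_1}},\dots,e_{K_{j_r}} \in \mathbb{G}_n^{r-1}$ such that the scalars $B_{J_{j_i}} := (e_{j_i}\wedge e_{K_{j_i}})^\dagger\cdot B$ are non-zero for $i=1,\dots,r$ and $$B = B_{J_{j_2}}^{-1}\cdots B_{J_{j_r}}^{-1}\,(e_{K_{j_1}}\cdot B)\wedge\cdots\wedge(e_{K_{j_r}}\cdot B).$$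
   Context: $\mathbb{G}_n$ is the geometric (Clifford) algebra of Euclidean space $\mathbb{R}^n$ with standard orthonormal basis $e_1,\dots,e_n$: it is the associative unital real algebra generated by $e_1,\dots,e_n$ subject to $e_i^2=1$ and $e_ie_j=-e_je_i$ for $i\ne j$. For a sequence $J=(j_1,\dots,j_k)$ of distinct indices in $\{1,\dots,n\}$ (in any order), $e_J=e_{j_1}e_{j_2}\cdots e_{j_k}$ is called a coordinate $k$-blade (coordinate vector if $k=1$; $e_\emptyset=1$). $\mathbb{G}_n^k$ denotes the linear span of the coordinate $k$-blades; its elements are called $k$-vectors, and $\mathbb{G}_n^1=\mathbb{R}^n$. $\langle X\rangle_k$ denotes the projection of $X\in\mathbb{G}_n$ onto $\mathbb{G}_n^k$. For $A\in\mathbb{G}_n^p$ and $C\in\mathbb{G}_n^q$, the inner product is $A\cdot C=\langle AC\rangle_{|p-q|}$ and the outer product is $A\wedge C=\langle AC\rangle_{p+q}$. The reverse $\dagger$ is the linear anti-automorphism with $(e_{j_1}\cdots e_{j_k})^\dagger=e_{j_k}\cdots e_{j_1}$. An $r$-blade is a non-zero $r$-vector that can be written as an outer product $v_1\wedge\cdots\wedge v_r$ of $r$ vectors $v_i\in\mathbb{R}^n$. *)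

(* Defs.v *)
From HB Require Import structures.
From mathcomp Require Import all_boot all_order all_algebra ring zify.

Set Implicit Arguments.
Unset Strict Implicit.
Unset Printing Implicit Defensive.

Import GRing.Theory.
Local Open Scope ring_scope.

(* The geometric algebra of F^n with the form e_i ^ 2 = 1.  An element is     *)
(* stored as its family of coefficients on the basis e_S = \prod_(i in S) e_i *)
(* (increasing product), with S ranging over the subsets of {0, ..., n - 1},  *)
(* and e_S * e_T = bsign S T *: e_(symdiff S T).  This is the algebra with    *)
(* generators e_i and relations e_i ^ 2 = 1, e_i e_j = - e_j e_i (i != j):    *)
(* see cvec_sq, cvecC, clifford_lift and clifford_lift_uniq.                  *)

Section SymDiff.
Variable n : nat.
Implicit Types S T U : {set 'I_n}.

Definition symdiff S T : {set 'I_n} := [set i | (i \in S) (+) (i \in T)].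

(* Number of transpositions that sort the word e_S e_T. *)
Definition inversions S T : nat :=
  (\sum_(i in S) \sum_(j in T) (j < i))%N.

Lemma symdiffA : associative symdiff.
Proof. by move=> S T U; apply/setP=> i; rewrite !inE addbA. Qed.

Lemma symdiffC : commutative symdiff.
Proof. by move=> S T; apply/setP=> i; rewrite !inE addbC. Qed.

Lemma symdiff0 : right_id set0 symdiff.
Proof. by move=> S; apply/setP=> i; rewrite !inE addbF. Qed.

Lemma sym0diff : left_id set0 symdiff.
Proof. by move=> S; rewrite symdiffC symdiff0. Qed.

Lemma symdiffK S : involutive (symdiff S).
Proof. by move=> T; apply/setP=> i; rewrite !inE addbA addbb. Qed.

Lemma symdiff_inj S : injective (symdiff S).
Proof. exact: inv_inj (symdiffK S). Qed.

Lemma symdiffKr T : involutive (symdiff^~ T).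
Proof. by move=> S; rewrite symdiffC (symdiffC S) symdiffK. Qed.

Lemma inversions0l T : inversions set0 T = 0%N.
Proof. by rewrite /inversions big_set0. Qed.

Lemma inversions0r S : inversions S set0 = 0%N.
Proof. by rewrite /inversions big1 // => i _; rewrite big_set0. Qed.

Lemma inversions1 i T : inversions [set i] T = (\sum_(j in T) (j < i))%N.
Proof. by rewrite /inversions big_set1. Qed.

Lemma inversions11 i j : inversions [set i] [set j] = (j < i)%N.
Proof. by rewrite inversions1 big_set1. Qed.

Let odd_inversions S T : odd (inversions S T) =
  \big[addb/false]_i \big[addb/false]_j [&& i \in S, j \in T & (j < i)%N].
Proof.
rewrite /inversions (big_morph odd oddD (erefl _)) big_mkcond /=.
apply: eq_bigr => i _; case: (i \in S) => /=; last by rewrite big1.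
rewrite (big_morph odd oddD (erefl _)) big_mkcond /=.
by apply: eq_bigr => j _; case: (j \in T); rewrite ?oddb.
Qed.

Lemma odd_inversionsDl S T U : odd (inversions (symdiff S T) U) =
  odd (inversions S U) (+) odd (inversions T U).
Proof.
rewrite !odd_inversions -big_split; apply: eq_bigr => i _.
by rewrite -big_split; apply: eq_bigr => j _; rewrite inE andb_addl.
Qed.

Lemma odd_inversionsDr S T U : odd (inversions S (symdiff T U)) =
  odd (inversions S T) (+) odd (inversions S U).
Proof.
rewrite !odd_inversions -big_split; apply: eq_bigr => i _.
rewrite -big_split; apply: eq_bigr => j _ /=.
by rewrite inE andb_addl andb_addr.
Qed.

End SymDiff.

Section Clifford.
Variables (F : fieldType) (n : nat).
Implicit Types (S T U : {set 'I_n}) (i j : 'I_n) (k p q : nat).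

Definition bsign S T : F := (-1) ^+ inversions S T.

Lemma bsignDl S T U : bsign (symdiff S T) U = bsign S U * bsign T U.
Proof. by rewrite /bsign -!(signr_odd _ (inversions _ _)) odd_inversionsDl signr_addb. Qed.

Lemma bsignDr S T U : bsign S (symdiff T U) = bsign S T * bsign S U.
Proof. by rewrite /bsign -!(signr_odd _ (inversions _ _)) odd_inversionsDr signr_addb. Qed.

Lemma bsign0l T : bsign set0 T = 1.
Proof. by rewrite /bsign inversions0l. Qed.

Lemma bsign0r S : bsign S set0 = 1.
Proof. by rewrite /bsign inversions0r. Qed.

Lemma bsign_sq S T : bsign S T * bsign S T = 1.
Proof. by rewrite -expr2 sqrr_sign. Qed.

Lemma bsign_neq0 S T : bsign S T != 0.
Proof. by rewrite signr_eq0. Qed.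

Definition clifford : Type := {ffun {set 'I_n} -> F^o}.
HB.instance Definition _ := Vector.on clifford.
Implicit Types x y z X : clifford.

Definition cbase S : clifford := [ffun T => (T == S)%:R].

Definition cmul x y : clifford :=
  [ffun U => \sum_S bsign S (symdiff S U) * (x S * y (symdiff S U))].

Fact cmulA : associative cmul.
Proof.
move=> x y z; apply/ffunP=> U; rewrite !ffunE.
under eq_bigr => S _ do rewrite ffunE mulr_sumr mulr_sumr.
under [RHS]eq_bigr => V _ do rewrite ffunE mulr_suml mulr_sumr.
rewrite [RHS]exchange_big /=; apply: eq_bigr => S _.
rewrite [RHS](reindex_inj (@symdiff_inj _ S)) /=; apply: eq_bigr => T _.
rewrite symdiffK -(symdiffA S T U) (symdiffC S (symdiff T U)) -symdiffA.
rewrite (symdiffC U S) !bsignDl !bsignDr -[LHS]mulr1 -(bsign_sq S T).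
ring.
Qed.

Fact cmul1l : left_id (cbase set0) cmul.
Proof.
move=> x; apply/ffunP=> U; rewrite ffunE (bigD1 set0) //= big1 => [|S /negPf S0].
  by rewrite ffunE eqxx sym0diff bsign0l !mul1r addr0.
by rewrite ffunE S0 mul0r mulr0.
Qed.

Fact cmul1r : right_id (cbase set0) cmul.
Proof.
move=> x; apply/ffunP=> U; rewrite ffunE (reindex_inj (@symdiff_inj _ U)) /=.
have UK S : symdiff (symdiff U S) U = S by rewrite (symdiffC U) symdiffKr.
rewrite (bigD1 set0) //= big1 => [|S /negPf S0].
  by rewrite ffunE UK symdiff0 eqxx bsign0r mul1r mulr1 addr0.
by rewrite ffunE UK S0 !mulr0.
Qed.

Fact cmulDl : left_distributive cmul +%R.
Proof.
move=> x y z; apply/ffunP=> U; rewrite !ffunE -big_split; apply: eq_bigr => S _ /=.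
by rewrite ffunE mulrDl mulrDr.
Qed.

Fact cmulDr : right_distributive cmul +%R.
Proof.
move=> x y z; apply/ffunP=> U; rewrite !ffunE -big_split; apply: eq_bigr => S _ /=.
by rewrite ffunE !mulrDr.
Qed.

Fact cone_neq0 : cbase set0 != 0.
Proof. by apply/eqP=> /ffunP/(_ set0)/eqP; rewrite !ffunE eqxx oner_eq0. Qed.

HB.instance Definition _ :=
  GRing.Zmodule_isNzRing.Build clifford cmulA cmul1l cmul1r cmulDl cmulDr cone_neq0.

Fact cscaleAl (a : F) x y : a *: (x * y) = (a *: x) * y.
Proof.
apply/ffunP=> U; rewrite !ffunE scaler_sumr; apply: eq_bigr => S _.
by rewrite ffunE /GRing.scale /= !mulrA (mulrC a).
Qed.

HB.instance Definition _ := GRing.Lmodule_isLalgebra.Build F clifford cscaleAl.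

Fact cscaleAr (a : F) x y : a *: (x * y) = x * (a *: y).
Proof.
apply/ffunP=> U; rewrite !ffunE scaler_sumr; apply: eq_bigr => S _.
by rewrite ffunE /GRing.scale /= mulrCA (mulrCA a).
Qed.

HB.instance Definition _ := GRing.Lalgebra_isAlgebra.Build F clifford cscaleAr.

Lemma cmulE x y U :
  (x * y) U = \sum_S bsign S (symdiff S U) * (x S * y (symdiff S U)).
Proof. by rewrite ffunE. Qed.

Lemma cbase0 : cbase set0 = 1.
Proof. by []. Qed.

Lemma cbaseE S T : cbase S T = (T == S)%:R.
Proof. by rewrite ffunE. Qed.

Lemma coeffD x y S : (x + y) S = x S + y S.
Proof. by rewrite ffunE. Qed.

Lemma coeffZ (a : F) x S : (a *: x) S = a * x S.
Proof. by rewrite ffunE. Qed.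

Lemma coeff_sum I (r : seq I) (P : pred I) (f : I -> clifford) S :
  (\sum_(i <- r | P i) f i) S = \sum_(i <- r | P i) f i S.
Proof. exact: sum_ffunE. Qed.

Lemma coeff_eq x y : (forall S, x S = y S) -> x = y.
Proof. by move=> xy; apply/ffunP. Qed.

Lemma cbaseM S T : cbase S * cbase T = bsign S T *: cbase (symdiff S T).
Proof.
apply: coeff_eq => U; rewrite coeffZ cmulE (bigD1 S) //= big1 => [|V /negPf SV].
  rewrite !cbaseE eqxx addr0 mul1r (can2_eq (symdiffK S) (symdiffK S)).
  by case: eqP => [->|_]; rewrite ?symdiffK ?mulr0.
by rewrite !cbaseE SV mul0r mulr0.
Qed.

Lemma cbase_sum x : x = \sum_S x S *: cbase S.
Proof.
apply: coeff_eq => U; rewrite coeff_sum (bigD1 U) //= big1 => [|S /negPf SU].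
  by rewrite coeffZ cbaseE eqxx mulr1 addr0.
by rewrite coeffZ cbaseE eq_sym SU mulr0.
Qed.

Definition cvec i : clifford := cbase [set i].

Lemma cvec_sq i : cvec i * cvec i = 1.
Proof.
rewrite cbaseM /bsign inversions11 ltnn scale1r -cbase0; congr cbase.
by apply/setP=> j; rewrite !inE addbb.
Qed.

Lemma cvecC i j : i != j -> cvec i * cvec j = - (cvec j * cvec i).
Proof.
move=> ij; rewrite !cbaseM symdiffC -scaleNr /bsign !inversions11.
by case: (ltngtP i j) => [||/val_inj/eqP]; rewrite ?(negPf ij) //= ?opprK.
Qed.

Lemma set_min_ind (Q : {set 'I_n} -> Prop) : Q set0 ->
    (forall i S, (forall j, j \in S -> i < j)%N -> Q S -> Q (symdiff [set i] S)) ->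
  forall S, Q S.
Proof.
move=> Q0 QS S; have [m] := ubnP #|S|; elim: m => // m IHm in S *.
have [->//|[i0 Si0]] := set_0Vmem S.
case: (arg_minnP (fun i => i : nat) Si0) => i Si mini leSm.
have {}Si : i \in S by [].
rewrite -(symdiffK [set i] S).
have ST : symdiff [set i] S = S :\ i.
  apply/setP=> j; rewrite !inE; case: eqP => [->|_].
    by rewrite Si.
  by case: (j \in S).
apply: QS => [j|].
  rewrite ST !inE => /andP[ji Sj]; rewrite ltn_neqAle mini // andbT.
  by rewrite eq_sym -val_eqE in ji *.
by apply: IHm; move: leSm; rewrite ST (cardsD1 i S) Si.
Qed.

Lemma bsign_min i S : (forall j, j \in S -> i < j)%N -> bsign [set i] S = 1.
Proof.
move=> iS; rewrite /bsign inversions1 big1 // => j /iS.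
by case: ltngtP.
Qed.

Section Presentation.
Variables (A : algType F) (f : 'I_n -> A).
Hypothesis f_sq : forall i, f i * f i = 1.
Hypothesis fC : forall i j, i != j -> f i * f j = - (f j * f i).

Local Notation P S := (\prod_(i in S) f i).

Lemma mul_prod_anticomm i T : f i * P T = bsign [set i] T *: P (symdiff [set i] T).
Proof.
rewrite /bsign inversions1.
have: sorted (fun a b : 'I_n => a < b)%N (index_enum 'I_n).
  by have := iota_ltn_sorted 0 n; rewrite -val_enum_ord sorted_map enumT [index_enum _]unlock.
have: i \in index_enum 'I_n by rewrite mem_index_enum.
elim: (index_enum _) => // a s IHs; rewrite inE !big_cons => ias srt.
have tr : transitive (fun a b : 'I_n => a < b)%N by move=> ? ? ?; apply: ltn_trans.
have {srt} [as_ srt] : all (fun b : 'I_n => a < b)%N s /\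
    sorted (fun a b : 'I_n => a < b)%N s.
  by split; [apply: order_path_min srt | apply: path_sorted srt].
have [ai|ai] := eqVneq i a; last first.
  have {ias} si : i \in s by move: ias; rewrite (negPf ai).
  have {}IHs := IHs si srt; rewrite !inE eq_sym (negPf ai) /=.
  have lt_ai : (a < i)%N by exact: (allP as_).
  case: (a \in T); last exact: IHs.
  by rewrite lt_ai mulrA fC // mulNr -mulrA IHs exprS mulN1r scaleNr scalerAr.
subst a; rewrite !inE eqxx ltnn.
have gt_is b : b \in s -> (i < b)%N by move/(allP as_).
have -> : (\sum_(b <- s | b \in T) (b < i) = 0)%N.
  by rewrite big_seq_cond big1 // => b /andP[/gt_is ib _]; rewrite ltnNge (ltnW ib).
rewrite if_same scale1r.
rewrite [in RHS]big_seq_cond (eq_bigl (fun b => (b \in s) && (b \in T))); last first.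
  move=> b; case sb: (b \in s) => //=; move/gt_is: sb; rewrite !inE.
  by case: eqP => [->|]; rewrite ?ltnn.
rewrite -big_seq_cond.
by case: (i \in T); rewrite //= mulrA f_sq mul1r.
Qed.

Let mulP S T : P S * P T = bsign S T *: P (symdiff S T).
Proof.
elim/set_min_ind: S => [|i S iS IHS].
  by rewrite big_set0 mul1r bsign0l scale1r sym0diff.
have := mul_prod_anticomm i S; rewrite bsign_min // scale1r => <-.
rewrite -mulrA IHS -scalerAr mul_prod_anticomm scalerA -symdiffA bsignDl; congr (_ *: _).
by rewrite bsignDr bsign_min // mul1r mulrC.
Qed.

Let lift x : A := \sum_S x S *: P S.

Let lift_linear : linear lift.
Proof.
move=> a x y; rewrite /lift scaler_sumr -big_split; apply: eq_bigr => S _ /=.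
by rewrite coeffD coeffZ scalerDl scalerA.
Qed.

Let lift_base S : lift (cbase S) = P S.
Proof.
rewrite /lift (bigD1 S) //= [X in _ + X]big1 => [|T /negPf TS].
  by rewrite cbaseE eqxx scale1r addr0.
by rewrite cbaseE TS scale0r.
Qed.

Let lift_morph : monoid_morphism lift.
Proof.
split=> [|x y]; first by rewrite -cbase0 lift_base big_set0.
rewrite {1}/lift; under eq_bigr do rewrite cmulE scaler_suml.
rewrite exchange_big /= {1}/lift mulr_suml; apply: eq_bigr => S _.
rewrite /lift mulr_sumr (reindex_inj (@symdiff_inj _ S)) /=; apply: eq_bigr => T _.
rewrite symdiffK -scalerAr -scalerAl mulP !scalerA; congr (_ *: _).
by ring.
Qed.

Lemma clifford_lift :
  exists phi : {lrmorphism clifford -> A}, forall i, phi (cvec i) = f i.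
Proof.
pose l1 := GRing.isLinear.Build F clifford A *:%R lift lift_linear.
pose l2 := GRing.isMonoidMorphism.Build clifford A lift lift_morph.
pose phi : {lrmorphism clifford -> A} := HB.pack lift l1 l2.
by exists phi => i; rewrite /= lift_base big_set1.
Qed.

End Presentation.

Lemma cbase_prod S : cbase S = \prod_(i in S) cvec i.
Proof.
elim/set_min_ind: S => [|i S iS IHS]; first by rewrite big_set0 cbase0.
have := mul_prod_anticomm cvec_sq cvecC i S; rewrite bsign_min // scale1r => <-.
by rewrite -IHS cbaseM bsign_min // scale1r.
Qed.

Lemma clifford_lift_uniq (A : algType F) (phi psi : {lrmorphism clifford -> A}) :
  (forall i, phi (cvec i) = psi (cvec i)) -> phi =1 psi.
Proof.
move=> eq_phi x; rewrite [x]cbase_sum !linear_sum; apply: eq_bigr => S _.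
rewrite !linearZ cbase_prod !rmorph_prod; congr (_ *: _).
by apply: eq_bigr => i _; exact: eq_phi.
Qed.

(* e_J = e_(j_1) ... e_(j_k); it is a coordinate k-blade when J is duplicate  *)
(* free, in any order.                                                        *)
Definition cblade (J : seq 'I_n) : clifford := \prod_(j <- J) cvec j.

Lemma cblade_uniq J : uniq J ->
  exists2 c : F, c != 0 & cblade J = c *: cbase [set i in J].
Proof.
elim: J => [_|i J IHJ /= /andP[Ji /IHJ[c c0 cJ]]].
  exists 1; rewrite ?oner_eq0 // /cblade big_nil scale1r -cbase0; congr cbase.
exists (bsign [set i] [set j in J] * c); first by rewrite mulf_neq0 ?bsign_neq0.
rewrite /cblade big_cons -/(cblade J) cJ -scalerAr cbaseM scalerA mulrC.
congr (_ *: cbase _); apply/setP=> j; rewrite !inE.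
by case: eqP => // ->; rewrite (negPf Ji).
Qed.

Definition coordinate_blades k : seq clifford :=
  [seq cblade J | J : k.-tuple 'I_n <- enum {: k.-tuple 'I_n} & uniq J].

Definition kvec k : {vspace clifford} := <<coordinate_blades k>>%VS.

(* Projection onto the k-vectors: see gproj_kvec, gproj_id, gproj_neq and     *)
(* gproj_sum.                                                                 *)
Definition gproj k X : clifford := [ffun S : {set 'I_n} => if #|S| == k then X S else 0].

Lemma gprojE k X S : gproj k X S = if #|S| == k then X S else 0.
Proof. by rewrite ffunE. Qed.

Fact gproj_linear k : linear (gproj k).
Proof.
move=> a x y; apply: coeff_eq => S; rewrite gprojE !(coeffD, coeffZ) !gprojE.
by case: ifP; rewrite // mulr0 addr0.
Qed.

HB.instance Definition _ k :=
  GRing.isLinear.Build F clifford clifford *:%R (gproj k) (gproj_linear k).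

Lemma cbase_kvec S : cbase S \in kvec #|S|.
Proof.
have [c c0 cS] := cblade_uniq (enum_uniq S).
have -> : cbase S = c^-1 *: cblade (enum S).
  rewrite cS scalerA mulVf // scale1r; congr cbase.
  by apply/setP=> i; rewrite inE mem_enum.
apply/memvZ/memv_span/mapP.
have sz : size (enum S) == #|S| by rewrite cardE.
by exists (Tuple sz); rewrite // mem_filter mem_enum enum_uniq.
Qed.

Lemma kvecP k x : reflect (forall S, x S != 0 -> #|S| = k) (x \in kvec k).
Proof.
apply: (iffP idP) => [xk S|xk].
  suff <- : gproj k x = x by rewrite gprojE; case: (#|S| =P k) => //; rewrite eqxx.
  have /span_lfunP/(_ x xk) :
      {in coordinate_blades k, linfun (gproj k) =1 \1%VF}.
    move=> y /mapP[J]; rewrite mem_filter => /andP[uJ _] ->.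
    have [c _ cJ] := cblade_uniq uJ.
    rewrite !lfunE /= cJ linearZ; congr (_ *: _).
    apply: coeff_eq => T; rewrite gprojE cbaseE.
    case: (T =P _) => [->|]; last by rewrite if_same.
    by rewrite cardsE (card_uniqP uJ) size_tuple eqxx.
  by rewrite !lfunE.
rewrite [x]cbase_sum memv_suml // => S _.
have [->|/xk <-] := eqVneq (x S) 0; first by rewrite scale0r mem0v.
exact/memvZ/cbase_kvec.
Qed.

Lemma gproj_kvec k X : gproj k X \in kvec k.
Proof.
apply/kvecP=> S; rewrite gprojE.
by case: (#|S| =P k) => //; rewrite eqxx.
Qed.

Lemma gproj_id k X : X \in kvec k -> gproj k X = X.
Proof.
move/kvecP=> Xk; apply: coeff_eq => S; rewrite gprojE.
by case: (#|S| =P k) => // neq; apply/esym/eqP/negPn/negP=> /Xk.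
Qed.

Lemma gproj_neq k l X : X \in kvec k -> k != l -> gproj l X = 0.
Proof.
move/kvecP=> Xk kl; apply: coeff_eq => S; rewrite gprojE ffunE.
case: eqP => // Sl; apply/eqP/negPn/negP=> /Xk Sk.
by rewrite -Sk Sl eqxx in kl.
Qed.

Lemma gproj_sum X : X = \sum_(k < n.+1) gproj k X.
Proof.
apply: coeff_eq => S; rewrite coeff_sum.
have Sn : (#|S| < n.+1)%N by rewrite ltnS -[leqRHS]card_ord max_card.
rewrite (bigD1 (Ordinal Sn)) //= gprojE eqxx big1 ?addr0 // => k kS.
by rewrite gprojE; case: eqP => // Sk; case/eqP: kS; apply: val_inj.
Qed.

(* Bilinear extensions of the products of homogeneous elements, on which they *)
(* are given by ginnerE and gouterE.                                          *)
Definition ginner X Y : clifford :=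
  \sum_(p < n.+1) \sum_(q < n.+1) gproj `|p - q|%N (gproj p X * gproj q Y).

Definition gouter X Y : clifford :=
  \sum_(p < n.+1) \sum_(q < n.+1) gproj (p + q) (gproj p X * gproj q Y).

Let gprod_homog (h : nat -> nat -> nat) p q X Y : X \in kvec p -> Y \in kvec q ->
  \sum_(p < n.+1) \sum_(q < n.+1) gproj (h p q) (gproj p X * gproj q Y)
    = gproj (h p q) (X * Y).
Proof.
move=> Xp Yq; have [-> | X0] := eqVneq X 0.
  rewrite [in RHS]mul0r linear0 big1 // => i _; rewrite big1 // => j _.
  by rewrite linear0 mul0r linear0.
have [-> | Y0] := eqVneq Y 0.
  rewrite [in RHS]mulr0 linear0 big1 // => i _; rewrite big1 // => j _.
  by rewrite linear0 mulr0 linear0.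
have lt_n k Z : Z \in kvec k -> Z != 0 -> (k < n.+1)%N.
  move=> Zk; apply: contraR => kn; rewrite (gproj_sum Z) big1 // => i _.
  rewrite (gproj_neq Zk) //; apply: contra kn => /eqP->; exact: ltn_ord.
have pn := lt_n _ _ Xp X0; have qn := lt_n _ _ Yq Y0.
rewrite (bigD1 (Ordinal pn)) //= [X in _ + X]big1 ?addr0 => [|i ip]; last first.
  rewrite big1 // => j _; rewrite (gproj_neq Xp) ?mul0r ?linear0 //.
  by rewrite eq_sym.
rewrite (bigD1 (Ordinal qn)) //= [X in _ + X]big1 ?addr0 => [|j jq]; last first.
  by rewrite (gproj_neq Yq) ?mulr0 ?linear0 // eq_sym.
by rewrite (gproj_id Xp) (gproj_id Yq).
Qed.

Lemma ginnerE p q X Y : X \in kvec p -> Y \in kvec q ->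
  ginner X Y = gproj `|p - q|%N (X * Y).
Proof. exact: (gprod_homog (fun p q => `|p - q|%N)). Qed.

Lemma gouterE p q X Y : X \in kvec p -> Y \in kvec q ->
  gouter X Y = gproj (p + q) (X * Y).
Proof. exact: (gprod_homog addn). Qed.

Lemma gouter_coeff X Y U : gouter X Y U = \sum_(S : {set 'I_n})
  (#|S| + #|symdiff S U| == #|U|)%N%:R *
  (bsign S (symdiff S U) * (X S * Y (symdiff S U))).
Proof.
have cardn (S : {set 'I_n}) : (#|S| < n.+1)%N by rewrite ltnS -[leqRHS]card_ord max_card.
rewrite coeff_sum; under eq_bigr do rewrite coeff_sum.
transitivity (\sum_(p < n.+1) \sum_(q < n.+1) \sum_(S : {set 'I_n}) (p + q == #|U|)%N%:R *
    (bsign S (symdiff S U) * (gproj p X S * gproj q Y (symdiff S U)))).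
  apply: eq_bigr => p _; apply: eq_bigr => q _; rewrite gprojE cmulE eq_sym.
  rewrite -mulr_sumr; case: eqP => _; by rewrite ?mul1r ?mul0r.
under eq_bigr do rewrite exchange_big.
rewrite exchange_big; apply: eq_bigr => S _ /=.
rewrite (bigD1 (Ordinal (cardn S))) //= [X in _ + X]big1 ?addr0 => [|p pS].
  rewrite (bigD1 (Ordinal (cardn (symdiff S U)))) //= [X in _ + X]big1 ?addr0 => [|q qS].
    by rewrite !gprojE !eqxx.
  rewrite (gprojE q); case: (#|symdiff S U| =P q) => [Sq|_]; last by rewrite !mulr0.
  by case/eqP: qS; apply: val_inj.
rewrite big1 // => q _; rewrite gprojE; case: (#|S| =P p) => [Sp|_].
  by case/eqP: pS; apply: val_inj.
by rewrite mul0r !mulr0.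
Qed.

Let card_symdiff S T : (#|symdiff S T| <= #|S| + #|T|)%N.
Proof.
apply: leq_trans (leq_subr #|S :&: T| _); rewrite -cardsU subset_leq_card //.
by apply/subsetP=> i; rewrite !inE; case: (i \in S); case: (i \in T).
Qed.

Lemma gouterA : associative gouter.
Proof.
move=> x y z; apply: coeff_eq => U; rewrite !gouter_coeff.
under eq_bigr => S _ do rewrite gouter_coeff 3!mulr_sumr.
under [RHS]eq_bigr => V _ do rewrite gouter_coeff mulr_suml 2!mulr_sumr.
rewrite [RHS]exchange_big /=; apply: eq_bigr => S _.
rewrite [RHS](reindex_inj (@symdiff_inj _ S)) /=; apply: eq_bigr => T _.
have := bsign_sq S T.
set W := symdiff T (symdiff S U).
have eW : symdiff (symdiff S T) U = W.
  by rewrite /W -(symdiffA S T U) !symdiffA (symdiffC S).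
have eSU : symdiff S U = symdiff T W by rewrite symdiffK.
have c1 := card_symdiff S T; have c2 := card_symdiff T W.
have c3 := card_symdiff (symdiff S T) W; have c4 := card_symdiff S (symdiff T W).
have eU1 : symdiff (symdiff S T) W = U by rewrite -eW symdiffK.
have eU2 : symdiff S (symdiff T W) = U by rewrite -eSU symdiffK.
rewrite symdiffK eW eSU; rewrite eU1 in c3; rewrite eU2 in c4.
have /(congr1 (fun b : bool => b%:R : F)) :
    (#|S| + #|symdiff T W| == #|U|) && (#|T| + #|W| == #|symdiff T W|) =
    (#|symdiff S T| + #|W| == #|U|) && (#|S| + #|T| == #|symdiff S T|) :> bool.
  by apply/andP/andP => -[/eqP d1 /eqP d2]; split; apply/eqP; lia.
rewrite -!mulnb !natrM bsignDl bsignDr => E _.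
set a := _%:R in E *; set b := _%:R in E *.
by ring: E.
Qed.

Lemma gouter1l : left_id 1 gouter.
Proof.
move=> x; apply: coeff_eq => U; rewrite gouter_coeff -cbase0.
rewrite (bigD1 set0) //= big1 => [|S /negPf S0].
  by rewrite cbaseE eqxx sym0diff cards0 add0n eqxx bsign0l !mul1r addr0.
by rewrite cbaseE S0 mul0r !mulr0.
Qed.

Lemma gouter1r : right_id 1 gouter.
Proof.
move=> x; apply: coeff_eq => U; rewrite gouter_coeff -cbase0.
rewrite (reindex_inj (@symdiff_inj _ U)) /=.
have UK S : symdiff (symdiff U S) U = S by rewrite (symdiffC U) symdiffKr.
rewrite (bigD1 set0) //= big1 => [|S /negPf S0].
  by rewrite UK cbaseE eqxx symdiff0 cards0 addn0 eqxx bsign0r !mul1r mulr1 addr0.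
by rewrite UK cbaseE S0 !mulr0.
Qed.

HB.instance Definition _ :=
  Monoid.isLaw.Build clifford 1 gouter gouterA gouter1l gouter1r.

(* Reversing the word e_S takes inversions S S transpositions: see grevM,     *)
(* grev_cvec and grev_cblade.                                                 *)
Definition grev X : clifford := [ffun S : {set 'I_n} => bsign S S * X S].

Fact grev_linear : linear grev.
Proof.
move=> a x y; apply: coeff_eq => S; rewrite ffunE !(coeffD, coeffZ) !ffunE.
by rewrite mulrDr mulrCA.
Qed.

HB.instance Definition _ :=
  GRing.isLinear.Build F clifford clifford *:%R grev grev_linear.

Lemma grevK : involutive grev.
Proof. by move=> x; apply: coeff_eq => S; rewrite !ffunE mulrA bsign_sq mul1r. Qed.

Lemma grev1 : grev 1 = 1.
Proof.
apply: coeff_eq => S; rewrite ffunE -cbase0 cbaseE.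
by case: eqP => [->|]; rewrite ?bsign0l ?mulr1 ?mulr0.
Qed.

Lemma grevM x y : grev (x * y) = grev y * grev x.
Proof.
apply: coeff_eq => U; rewrite ffunE !cmulE mulr_sumr.
rewrite [RHS](reindex_inj (can_inj (symdiffKr U))) /=; apply: eq_bigr => S _.
rewrite symdiffKr !ffunE; have [T ->] : exists T, U = symdiff S T.
  by exists (symdiff S U); rewrite symdiffK.
rewrite symdiffK !bsignDl !bsignDr; have e := bsign_sq S T.
by ring: e.
Qed.

Lemma grev_cvec i : grev (cvec i) = cvec i.
Proof.
apply: coeff_eq => S; rewrite ffunE cbaseE; case: eqP => [->|]; last by rewrite mulr0.
by rewrite /bsign inversions11 ltnn mul1r.
Qed.

Lemma grev_cblade J : grev (cblade J) = cblade (rev J).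
Proof.
elim: J => [|i J IHJ]; first by rewrite /cblade !big_nil grev1.
rewrite {1}/cblade big_cons grevM IHJ grev_cvec.
by rewrite rev_cons -cats1 /cblade big_cat big_seq1.
Qed.

Definition is_blade r X : Prop :=
  [/\ X \in kvec r, X != 0 &
      exists2 v : 'I_r -> clifford, (forall i : 'I_r, v i \in kvec 1)
        & X = \big[gouter/1]_(i < r) v i].

Definition plucker r X : Prop :=
  forall A : clifford, A \in kvec r.-1 -> gouter (ginner A X) X = 0.

End Clifford.

Arguments cvec F {n} i.
Arguments cblade F {n} J.
Arguments cbase F {n} S.

(* Main.v *)
From HB Require Import structures.
Require Import Defs.
From mathcomp Require Import all_boot all_order all_algebra.
From mathcomp Require Import reals ring zify.

Set Implicit Arguments.
Unset Strict Implicit.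
Unset Printing Implicit Defensive.

Import GRing.Theory.
Local Open Scope ring_scope.

(** The whole argument rests on one operator: the left contraction
    [contract a] by the coordinate vector e_a, an antiderivation of the outer
    product ([contract_gouter]):
      contract a (u /\ X) = u_a X - u /\ contract a X   for a vector u.
    Iterated along a word K it computes the inner product with the coordinate
    blade e_K ([ginner_cblade]).

    A blade satisfies the relations.  If B = v_1 /\ ... /\ v_r, contracting a
    product of the v_i gives a combination of products of the v_i with one
    factor less, so A . B lies in the span of the v_i ([contract_gwedge]); and
    v_i /\ B = 0 because v_i is repeated.

    The relations produce the factorization.  If w /\ B = 0 for a vector w with
    w_a <> 0, applying [contract a] to this equation gives
    B = w_a^-1 w /\ contract a B ([gouter_divide]).  Take an index set
    J = {j_1, ..., j_r} with B_J <> 0 and w_i = e_(K_i) . B, where K_i is a word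
    on J minus j_i.  The relations say w_i /\ B = 0; and, among the
    coordinates indexed by J, w_i has only the j_i one nonzero.  So the
    divisions can be chained ([gwedge_divide]) and
      B = c (\prod_i (w_i)_(j_i)^-1) w_1 /\ ... /\ w_r,
    where the scalar c is the inner product of e_(j_r) ... e_(j_1) with B.

    Signs.  Let eps be the sign of the reversal of words on J.  Then
    (w_i)_(j_i) = eps b_i, where b_i = (e_(j_i) /\ e_(K_i))^rev . B.  The
    expected scalar \prod_(i > 1) b_i^-1 comes out exactly when
    b_1 = eps^r c.  This is a condition on the order of the word K_1; it holds
    for K_1 = j_2 ... j_r if r is even, and for its reverse if r is odd. *)

(** * Bilinearity and coefficients of the products *)

Lemma span_ind (F : fieldType) (E : vectType F) (X : seq E) (P : E -> Prop) :
    P 0 -> (forall x, x \in X -> P x) ->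
    (forall c x y, P x -> P y -> P (c *: x + y)) ->
  forall x, x \in <<X>>%VS -> P x.
Proof.
move=> P0 PX PD x /(@coord_span _ _ _ (in_tuple X)) ->.
elim/big_rec: _ => // i y _; apply: PD; apply: PX.
exact: mem_nth.
Qed.

Section OuterProduct.
Variables (F : fieldType) (n : nat).
Implicit Types (S T U : {set 'I_n}) (a b : 'I_n) (u v X Y : clifford F n).

Fact gouter_linear X : linear (gouter X).
Proof.
move=> c Y Z; apply: coeff_eq => U.
rewrite !(coeffD, coeffZ, gouter_coeff) mulr_sumr -big_split.
by apply: eq_bigr => S _ /=; rewrite coeffD coeffZ; ring.
Qed.

HB.instance Definition _ X :=
  GRing.isLinear.Build F (clifford F n) (clifford F n) *:%R (gouter X)
    (gouter_linear X).

Definition gouterr Y X : clifford F n := gouter X Y.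

Fact gouterr_linear Y : linear (gouterr Y).
Proof.
move=> c X Z; apply: coeff_eq => U.
rewrite /gouterr !(coeffD, coeffZ, gouter_coeff) mulr_sumr -big_split.
by apply: eq_bigr => S _ /=; rewrite coeffD coeffZ; ring.
Qed.

HB.instance Definition _ Y :=
  GRing.isLinear.Build F (clifford F n) (clifford F n) *:%R (gouterr Y)
    (gouterr_linear Y).

Lemma gouterDl X Y Z : gouter (X + Y) Z = gouter X Z + gouter Y Z.
Proof. exact: (linearD (gouterr Z)). Qed.

Lemma gouter0l X : gouter 0 X = 0.
Proof. exact: (linear0 (gouterr X)). Qed.

Lemma gouterZl c X Y : gouter (c *: X) Y = c *: gouter X Y.
Proof. exact: (linearZ_LR (gouterr Y)). Qed.

Lemma gouter_suml I (s : seq I) (P : pred I) (f : I -> clifford F n) X :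
  gouter (\sum_(i <- s | P i) f i) X = \sum_(i <- s | P i) gouter (f i) X.
Proof. exact: (linear_sum (gouterr X)). Qed.

Lemma in_symdiff1 a b S : (b \in symdiff [set a] S) = (b == a) (+) (b \in S).
Proof. by rewrite !inE. Qed.

Lemma card_symdiff1 a S :
  #|symdiff [set a] S| = (if a \in S then #|S|.-1 else #|S|.+1).
Proof.
case: ifP => aS.
  rewrite (cardsD1 a S) aS; apply: eq_card => b; rewrite !inE.
  by case: eqP => [->|]; rewrite ?aS.
rewrite -[RHS](add1n #|S|) -(cards1 a) (_ : symdiff _ _ = a |: S).
  by rewrite cardsU1 aS cards1.
by apply/setP=> b; rewrite !inE; case: eqP => [->|]; rewrite ?aS.
Qed.

Lemma bsign11 a : bsign F [set a] [set a] = 1.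
Proof. by rewrite /bsign inversions11 ltnn. Qed.

Lemma bsign1C a b : a != b ->
  bsign F [set a] [set b] = - bsign F [set b] [set a].
Proof.
move=> ab; rewrite /bsign !inversions11.
by case: (ltngtP a b) => [||/val_inj/eqP]; rewrite ?(negPf ab) //= ?opprK.
Qed.

Lemma cbase_mul_coeff S X U :
  (cbase F S * X) U = bsign F S (symdiff S U) * X (symdiff S U).
Proof.
rewrite cmulE (bigD1 S) //= big1 => [|T /negPf TS].
  by rewrite cbaseE eqxx mul1r addr0.
by rewrite cbaseE TS mul0r mulr0.
Qed.

Lemma gouter_cvec_coeff a X U : gouter (cvec F a) X U =
  if a \in U then bsign F [set a] (symdiff [set a] U) * X (symdiff [set a] U)
  else 0.
Proof.
rewrite gouter_coeff (bigD1 [set a]) //= big1 => [|T /negPf TS].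
  rewrite cbaseE eqxx mul1r addr0 cards1 card_symdiff1; case: ifP => aU.
    by rewrite (cardsD1 a U) aU /= eqxx mul1r.
  by rewrite gtn_eqF ?mul0r // add1n ltnS leqnSn.
by rewrite cbaseE TS mul0r !mulr0.
Qed.

Lemma kvec1_sum u : u \in kvec F n 1 -> u = \sum_a u [set a] *: cvec F a.
Proof.
move/kvecP=> u1; apply: coeff_eq => S; rewrite coeff_sum.
have [/eqP/cards1P[a ->]|S1] := eqVneq #|S| 1%N.
  rewrite (bigD1 a) //= big1 ?addr0 => [|b /negPf ba].
    by rewrite coeffZ cbaseE eqxx mulr1.
  by rewrite coeffZ cbaseE (inj_eq set1_inj) eq_sym ba mulr0.
rewrite big1 => [|b _]; first by have [//|/u1 S1'] := eqVneq (u S) 0; rewrite S1' in S1.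
rewrite coeffZ cbaseE; case: (S =P _) S1 => [->|]; first by rewrite cards1.
by rewrite mulr0.
Qed.

(** * Contraction by a coordinate vector *)

(** The terms of e_a * X whose index set avoids a: the product with a removes
    a from an index set that contains it. *)
Definition contract a X : clifford F n :=
  [ffun S : {set 'I_n} => if a \in S then 0
     else bsign F [set a] (symdiff [set a] S) * X (symdiff [set a] S)].

Lemma contractE a X S : contract a X S = if a \in S then 0
  else bsign F [set a] (symdiff [set a] S) * X (symdiff [set a] S).
Proof. by rewrite ffunE. Qed.

Fact contract_linear a : linear (contract a).
Proof.
move=> c X Y; apply: coeff_eq => S; rewrite !(coeffD, coeffZ, contractE).
by case: ifP => _; ring.
Qed.

HB.instance Definition _ a :=
  GRing.isLinear.Build F (clifford F n) (clifford F n) *:%R (contract a)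
    (contract_linear a).

(** On the coefficient at U, the four cases given by the membership of a and b
    in U; for a <> b the sign comes from e_a e_b = - e_b e_a. *)
Lemma contract_gouter_cvec a b X : contract a (gouter (cvec F b) X) =
  (a == b)%:R *: X - gouter (cvec F b) (contract a X).
Proof.
apply: coeff_eq => U; rewrite coeffD -scaleN1r !coeffZ mulN1r.
rewrite contractE !gouter_cvec_coeff contractE !in_symdiff1.
rewrite (symdiffA [set b]) (symdiffC [set b]) -symdiffA.
have [<-|ab] := eqVneq a b.
  rewrite symdiffK !bsignDr bsign11 !mul1r.
  by case: (a \in U); rewrite /= mulrA bsign_sq mul1r ?subrr ?subr0.
rewrite mul0r sub0r /=.
have e := bsign_sq F [set a] [set b].
case: (a \in U); case: (b \in U); rewrite ?mulr0 ?oppr0 //.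
by rewrite !bsignDr (bsign1C ab); ring.
Qed.

Lemma contract_gouter a u X : u \in kvec F n 1 ->
  contract a (gouter u X) = u [set a] *: X - gouter u (contract a X).
Proof.
move/kvec1_sum => {1 3}->; rewrite !gouter_suml linear_sum /=.
under eq_bigr do rewrite gouterZl linearZ /= contract_gouter_cvec scalerBr scalerA.
rewrite sumrB; congr (_ - _); last by apply: eq_bigr => b _; rewrite gouterZl.
rewrite (bigD1 a) //= eqxx mulr1 big1 ?addr0 // => b /negPf ba.
by rewrite eq_sym ba mulr0 scale0r.
Qed.

Lemma contract1 a : contract a 1 = 0.
Proof.
apply: coeff_eq => S; rewrite contractE [RHS]ffunE; case: ifP => // aS.
rewrite -cbase0 cbaseE (_ : (_ == _) = false) ?mulr0 //.
by apply/negP => /eqP/setP/(_ a); rewrite !inE eqxx aS.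
Qed.

Lemma contract_kvec1 a u : u \in kvec F n 1 ->
  contract a u = (u [set a] : F)%:A.
Proof.
move=> u1; rewrite -[u in LHS]gouter1r contract_gouter //.
by rewrite contract1 linear0 subr0.
Qed.

(** Contraction by a exposes the coefficient at any index set containing a. *)
Lemma contract_eq0 X : (forall a, contract a X = 0) -> X set0 = 0 -> X = 0.
Proof.
move=> cX X0; apply: coeff_eq => S; rewrite [RHS]ffunE.
have [->//|[a aS]] := set_0Vmem S.
have /(congr1 (fun Y : clifford F n => Y (symdiff [set a] S))) := cX a.
rewrite contractE in_symdiff1 eqxx aS symdiffK [RHS]ffunE => /eqP.
by rewrite mulf_eq0 (negPf (bsign_neq0 _ _ _)) => /eqP.
Qed.

(** Contracting u /\ u by any a gives u_a u - u_a u = 0.  Unlike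
    polarization of the square, this is valid in characteristic 2. *)
Lemma gouter_vv u : u \in kvec F n 1 -> gouter u u = 0.
Proof.
move=> u1; apply: contract_eq0 => [a|].
  rewrite contract_gouter // contract_kvec1 // linearZ /= gouter1r.
  by rewrite subrr.
by rewrite (gouterE u1 u1) gprojE cards0.
Qed.

Lemma gouter_vC u v : u \in kvec F n 1 -> v \in kvec F n 1 ->
  gouter u v = - gouter v u.
Proof.
move=> u1 v1; apply/eqP; rewrite -addr_eq0; apply/eqP.
have := gouter_vv (rpredD u1 v1).
by rewrite gouterDl !linearD /= !gouter_vv // add0r addr0.
Qed.

(** * Inner products with coordinate blades *)

Definition contracts (s : seq 'I_n) X := foldr contract X s.

Lemma contracts_kvec s q X : X \in kvec F n q -> (size s <= q)%N ->
  contracts s X \in kvec F n (q - size s).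
Proof.
move=> Xq; elim: s => [|a s IHs] /= sq; first by rewrite subn0.
have /kvecP sX := IHs (ltnW sq); apply/kvecP => S.
rewrite contractE; case: ifP => [|aS]; first by rewrite eqxx.
rewrite mulf_eq0 negb_or => /andP[_ /sX].
by rewrite card_symdiff1 aS; lia.
Qed.

(** Each factor e_a lowers degrees by at most one, and only its contraction
    part does so; hence the terms of lowest possible degree in e_s * X are
    those of the iterated contraction. *)
Lemma cblade_mul_low s q X S : X \in kvec F n q -> (#|S| + size s <= q)%N ->
  (cblade F s * X) S = contracts s X S.
Proof.
move=> Xq; elim: s S => [|a s IHs] S /= sq.
  by rewrite /cblade big_nil mul1r.
rewrite /cblade big_cons -mulrA -/(cblade F s) cbase_mul_coeff contractE.
have cT := card_symdiff1 a S; case: ifP cT => aS cT; last first.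
  by rewrite IHs // cT addSnnS.
have S0 : (0 < #|S|)%N by rewrite (cardsD1 a) aS.
rewrite IHs ?cT; last by rewrite (leq_trans _ sq) // leq_add ?leq_pred.
have /kvecP sX : contracts s X \in kvec F n (q - size s).
  by apply: contracts_kvec => //; apply: leq_trans sq; rewrite addnS leqW ?leq_addl.
have [->|/sX] := eqVneq (contracts s X (symdiff [set a] S)) 0.
  by rewrite mulr0.
by move: cT S0 sq => ->; case: #|S| => // c _ sq /= cq; exfalso; lia.
Qed.

Lemma cblade_kvec s : uniq s -> cblade F s \in kvec F n (size s).
Proof.
move=> us; have [c _ ->] := cblade_uniq F us; apply: memvZ.
by have := cbase_kvec F [set i in s]; rewrite cardsE (card_uniqP us).
Qed.

Lemma ginner_cblade s q X : uniq s -> X \in kvec F n q -> (size s <= q)%N ->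
  ginner (cblade F s) X = contracts s X.
Proof.
move=> us Xq sq; rewrite (ginnerE (cblade_kvec us) Xq) distnEr //.
apply: coeff_eq => S; rewrite gprojE; case: (#|S| =P _) => [Ss|/eqP Ss].
  by rewrite (cblade_mul_low Xq) // Ss subnK.
have /kvecP sX := contracts_kvec Xq sq.
by have [//|/sX Ss'] := eqVneq (contracts s X S) 0; rewrite Ss' eqxx in Ss.
Qed.

Lemma gouter_cvec_cblade a s : uniq (a :: s) ->
  gouter (cvec F a) (cblade F s) = cblade F (a :: s).
Proof.
move=> us; have /andP[_ us'] := us.
have a1 : cvec F a \in kvec F n 1 by rewrite -(cards1 a) cbase_kvec.
rewrite (gouterE a1 (cblade_kvec us')).
by have := gproj_id (cblade_kvec us); rewrite {1}/cblade big_cons.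
Qed.

(** Contractions only remove indices, so an index once removed stays absent. *)
Lemma contracts_disjoint a s S X : a \in s -> a \in S -> contracts s X S = 0.
Proof.
elim: s S => //= b s IHs S; rewrite inE contractE.
case: ifPn => // bS /orP[/eqP ab|sa] Sa; first by rewrite -ab Sa in bS.
rewrite IHs ?mulr0 // in_symdiff1 Sa.
by case: eqP => // ab; rewrite -ab Sa in bS.
Qed.

Lemma contract_scalar a X : contract a X set0 = X [set a].
Proof. by rewrite contractE inE symdiff0 bsign11 mul1r. Qed.

(** * Blades satisfy the relations *)

Definition gwedge k (v : 'I_k -> clifford F n) (s : seq 'I_k) : clifford F n :=
  \big[@gouter F n/1]_(i <- s) v i.

Section Blade.
Variables (k : nat) (v : 'I_k -> clifford F n).
Hypothesis v1 : forall i, v i \in kvec F n 1.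

Lemma gouter_gwedge_mem i s : i \in s -> gouter (v i) (gwedge v s) = 0.
Proof.
elim: s => // j s IHs; rewrite inE /gwedge big_cons gouterA.
case: eqP => [<- _|_ /= /IHs is0].
  by rewrite gouter_vv // gouter0l.
by rewrite (gouter_vC (v1 i) (v1 j)) -scaleN1r gouterZl -gouterA is0 linear0 scaler0.
Qed.

Definition gwedge_span m : {vspace clifford F n} :=
  <<[seq gwedge v (t : m.-tuple 'I_k) | t : m.-tuple 'I_k]>>%VS.

Lemma gwedge_in_span s m : size s = m -> gwedge v s \in gwedge_span m.
Proof.
by move=> <-; apply/memv_span/mapP; exists (in_tuple s); rewrite ?mem_enum.
Qed.

(** By the antiderivation rule: contraction either removes the first factor
    at the cost of a scalar, or keeps it and acts on the remaining ones. *)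
Lemma contract_gwedge a s : contract a (gwedge v s) \in gwedge_span (size s).-1.
Proof.
elim: s => [|i s IHs]; first by rewrite /gwedge big_nil contract1 mem0v.
rewrite /gwedge big_cons -/(gwedge v s) contract_gouter //=.
apply: memvB; first exact/memvZ/gwedge_in_span.
case: s IHs => [|l s] IHs.
  by rewrite /gwedge big_nil contract1 linear0 mem0v.
elim/span_ind: IHs => [|x /mapP[t _ ->]|c x y Ex Ey].
- by rewrite linear0 mem0v.
- rewrite (_ : gouter _ _ = gwedge v (i :: t)); last by rewrite /gwedge big_cons.
  by apply: gwedge_in_span; rewrite /= size_tuple.
- by rewrite linearP; apply: memvD => //; exact: memvZ.
Qed.

Lemma contract_gwedge_span a m x : x \in gwedge_span m ->
  contract a x \in gwedge_span m.-1.
Proof.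
elim/span_ind => [|y /mapP[t _ ->]|c y z Ey Ez].
- by rewrite linear0 mem0v.
- by have := contract_gwedge a t; rewrite size_tuple.
- by rewrite linearP; apply: memvD => //; exact: memvZ.
Qed.

Lemma contracts_gwedge_span s m x : x \in gwedge_span m ->
  contracts s x \in gwedge_span (m - size s).
Proof.
move=> Ex; elim: s => [|a s IHs] /=; first by rewrite subn0.
by rewrite subnS; apply: contract_gwedge_span.
Qed.

End Blade.

Lemma blade_plucker r X : is_blade r.+1 X -> plucker r.+1 X.
Proof.
case=> Xr _ [v v1 defX] A; rewrite /= => Ar.
have XE : X \in gwedge_span v r.+1.
  by rewrite defX; apply: gwedge_in_span; rewrite [index_enum _]unlock -enumT size_enum_ord.
have : ginner A X \in gwedge_span v 1.
  rewrite (ginnerE Ar Xr); elim/span_ind: Ar => [|x /mapP[t]|c x y Ex Ey].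
  - by rewrite mul0r linear0 mem0v.
  - rewrite mem_filter => /andP[ut _] ->.
    have tr : size t = r by rewrite size_tuple.
    rewrite -{1}tr -(ginnerE (cblade_kvec ut) Xr).
    rewrite (ginner_cblade ut Xr) ?tr //.
    by have := contracts_gwedge_span v1 t XE; rewrite tr subSnn.
  - by rewrite mulrDl -scalerAl linearP; apply: memvD => //; exact: memvZ.
elim/span_ind => [|x /mapP[t _ ->]|c x y Ex Ey].
- by rewrite gouter0l.
- case/tupleP: t => i t; rewrite /gwedge /= big_cons tuple0 big_nil gouter1r.
  by rewrite defX; apply: gouter_gwedge_mem; rewrite ?mem_index_enum.
- by rewrite gouterDl gouterZl Ex Ey scaler0 addr0.
Qed.

(** * Factorization from the relations *)

(** Contract the equation w /\ X = 0 by a. *)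
Lemma gouter_divide a w X : w \in kvec F n 1 -> w [set a] != 0 ->
  gouter w X = 0 -> X = (w [set a])^-1 *: gouter w (contract a X).
Proof.
move=> w1 wa wX; have := contract_gouter a X w1.
rewrite wX linear0 => /esym/eqP; rewrite subr_eq0 => /eqP <-.
by rewrite scalerA mulVf // scale1r.
Qed.

(** Chained divisions by the w_i.  The vectors that remain still annihilate
    the quotient Y = contract (j i) X, since contracting w_l /\ X = 0 by j i
    gives w_l /\ Y = (w_l)_(j_i) X = 0. *)
Lemma gwedge_divide k (j : 'I_k -> 'I_n) (w : 'I_k -> clifford F n) s X :
    (forall i, w i \in kvec F n 1) -> (forall i, w i [set j i] != 0) ->
    (forall i l, i != l -> w i [set j l] = 0) -> uniq s ->
    (forall i, i \in s -> gouter (w i) X = 0) ->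
  X = (\prod_(i <- s) (w i [set j i])^-1) *:
        gouter (gwedge w s) (contracts (rev (map j s)) X).
Proof.
move=> w1 wj wd; elim: s X => [|i s IHs] X /=.
  by rewrite /gwedge !big_nil scale1r gouter1l.
case/andP=> si us wX; rewrite /gwedge !big_cons -/(gwedge w s).
rewrite rev_cons /contracts foldr_rcons -/(contracts _ _).
have wX' l : l \in s -> gouter (w l) (contract (j i) X) = 0.
  move=> sl; have := contract_gouter (j i) X (w1 l).
  rewrite wX ?in_cons ?sl ?orbT // linear0 wd; last first.
    by apply: contraNneq si => <-.
  by rewrite scale0r sub0r => /esym/eqP; rewrite oppr_eq0 => /eqP.
rewrite {1}(gouter_divide (w1 i) (wj i) (wX i (mem_head i s))).
by rewrite {1}(IHs _ us wX') linearZ_LR /= scalerA gouterA.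
Qed.

Lemma kvec0E X : X \in kvec F n 0 -> X = (X set0 : F)%:A.
Proof.
move/kvecP=> X0; apply: coeff_eq => S; rewrite coeffZ -cbase0 cbaseE.
case: (eqVneq S set0) => [->|S0]; first by rewrite mulr1.
have [->|/X0/eqP] := eqVneq (X S) 0; first by rewrite mulr0.
by rewrite cards_eq0 (negPf S0).
Qed.

(** A word s whose length is the degree of X contracts X to a scalar, which
    is the coefficient of X at s up to a sign. *)
Section Scalar.
Variables (X : clifford F n) (s : seq 'I_n).
Hypotheses (us : uniq s) (Xs : X \in kvec F n (size s)).

Lemma contracts_full : contracts s X set0 = (cblade F s * X) set0.
Proof. by rewrite (cblade_mul_low Xs) // cards0. Qed.

Lemma contracts_full_neq0 : X [set a in s] != 0 -> contracts s X set0 != 0.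
Proof.
have [c c0 cs] := cblade_uniq F us.
rewrite contracts_full cs -scalerAl coeffZ cbase_mul_coeff symdiff0 => Xs0.
by rewrite !mulf_neq0 ?bsign_neq0.
Qed.

Lemma contracts_full_rev : contracts (rev s) X set0 =
  bsign F [set a in s] [set a in s] * contracts s X set0.
Proof.
have [c c0 cs] := cblade_uniq F us.
have -> : contracts (rev s) X set0 = (cblade F (rev s) * X) set0.
  by rewrite (cblade_mul_low Xs) // cards0 size_rev.
rewrite contracts_full -grev_cblade cs linearZ /=.
rewrite (_ : grev (cbase F _) =
  bsign F [set a in s] [set a in s] *: cbase F [set a in s]).
  by rewrite -!scalerAl !coeffZ mulrCA.
apply: coeff_eq => T; rewrite ffunE coeffZ !cbaseE.
by case: eqP => [->|]; rewrite ?mulr0.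
Qed.

End Scalar.

(** The vector e_a anticommutes with each of an even number of letters. *)
Lemma cblade_rcons_cons a s : a \notin s -> ~~ odd (size s) ->
  cblade F (rcons s a) = cblade F (a :: s).
Proof.
move=> as_ os; suff: cblade F (a :: s) = (-1) ^+ size s *: cblade F (rcons s a).
  by rewrite -signr_odd (negPf os) scale1r => ->.
elim: s as_ {os} => [|b s IHs]; first by rewrite scale1r.
rewrite inE negb_or => /andP[ab /IHs]; rewrite /cblade /= !big_cons => IH.
rewrite mulrA cvecC // mulNr -mulrA IH exprS -scalerAr mulN1r.
by rewrite scaleNr.
Qed.

Section PluckerFactorization.
Variables (r : nat) (B : clifford F n) (L : r.+1.-tuple 'I_n).
Hypotheses (uL : uniq L) (Br : B \in kvec F n r.+1) (pB : plucker r.+1 B).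
Hypothesis BL0 : B [set a in L] != 0.

Let j := tnth L.

(** The order of the letters makes the sign of the factorization come out right,
    through the word of the first index: see [b0E]. *)
Definition complement_word (i : 'I_r.+1) : seq 'I_n :=
  let s := rem (tnth L i) L in if odd r.+1 then rev s else s.
Let K := complement_word.

Let perm_K i : perm_eq (j i :: K i) L.
Proof.
rewrite perm_sym (perm_trans (perm_to_rem (mem_tnth i L))) // perm_cons.
by rewrite /K /complement_word; case: ifP; rewrite // perm_sym perm_rev.
Qed.

Let uniq_jK i : uniq (j i :: K i).
Proof. by rewrite (perm_uniq (perm_K i)). Qed.

Let size_jK i : size (j i :: K i) = r.+1.
Proof. by rewrite (perm_size (perm_K i)) size_tuple. Qed.

Lemma size_complement_word i : size (K i) == r.
Proof. by case: (size_jK i) => ->. Qed.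

Let set_jK i : [set a in j i :: K i] = [set a in L].
Proof. by apply/setP=> a; rewrite !inE -in_cons (perm_mem (perm_K i)). Qed.

Let w i := contracts (K i) B.
(* The sign by which reversal acts on words with the letters of L. *)
Let eps : F := bsign F [set a in L] [set a in L].
Let b i : F := contracts (rev (j i :: K i)) B set0.

Let jKr i : B \in kvec F n (size (j i :: K i)).
Proof. by rewrite size_jK. Qed.

Let w_diag i : w i [set j i] = contracts (j i :: K i) B set0.
Proof. by rewrite -contract_scalar. Qed.

Let w_diagE i : w i [set j i] = eps * b i.
Proof.
by rewrite w_diag /b (contracts_full_rev (uniq_jK i)) // set_jK mulrA bsign_sq mul1r.
Qed.

Let w_diag_neq0 i : w i [set j i] != 0.
Proof. by rewrite w_diag contracts_full_neq0 // set_jK. Qed.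

Let b_neq0 i : b i != 0.
Proof. by have := w_diag_neq0 i; rewrite w_diagE mulf_eq0 negb_or => /andP[]. Qed.

Let w_kvec i : w i \in kvec F n 1.
Proof.
have [sK] := size_jK i.
by have := @contracts_kvec (K i) r.+1 B Br; rewrite sK subSnn; apply.
Qed.

Lemma uniq_complement_word i : uniq (K i).
Proof. by have /andP[] := uniq_jK i. Qed.

Let ginner_K i : ginner (cblade F (K i)) B = w i.
Proof.
have [sK] := size_jK i.
by rewrite (ginner_cblade (uniq_complement_word i) Br) // sK.
Qed.

Let w_gouter i : gouter (w i) B = 0.
Proof.
have [sK] := size_jK i; rewrite -ginner_K; apply: pB.
by have := cblade_kvec (uniq_complement_word i); rewrite sK.
Qed.

Let w_offdiag i l : i != l -> w i [set j l] = 0.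
Proof.
move=> il; apply: (@contracts_disjoint (j l)); last by rewrite inE.
have := perm_mem (perm_K i) (j l); rewrite mem_tnth inE.
by case: eqP => // /(tuple_uniqP _ uL)/esym/eqP; rewrite (negPf il).
Qed.

Let contracts_L : contracts (rev L) B set0 = eps * contracts L B set0.
Proof. by apply: contracts_full_rev; rewrite ?size_tuple. Qed.

Let eps_expr k : eps ^+ k = if odd k then eps else 1.
Proof.
rewrite -[in LHS](odd_double_half k) exprD -mul2n exprM expr2 bsign_sq expr1n mulr1.
by case: odd.
Qed.

(** The constraint that fixes the order of K_1.  For r + 1 odd, reversing
    j_1 K_1 moves j_1 past r letters, an even number, back to the front of the
    word L. *)
Let b0E : b ord0 = eps ^+ r.+1 * contracts (rev L) B set0.
Proof.
have LE : L = j ord0 :: behead L :> seq _ by rewrite {1}(tuple_eta L).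
have remE : rem (j ord0) L = behead L by rewrite [in LHS]LE /= eqxx.
have /andP[jL uL'] : uniq (j ord0 :: behead L) by rewrite -LE.
have sL' : size (behead L) = r by rewrite size_behead size_tuple.
rewrite /b /K /complement_word remE eps_expr; case: ifP => odd_r.
  have ur : uniq (rcons (behead L) (j ord0)) by rewrite rcons_uniq jL.
  rewrite rev_cons revK contracts_full //; last by rewrite size_rcons sL'.
  rewrite cblade_rcons_cons ?sL' //.
  rewrite -LE -contracts_full ?size_tuple // contracts_L.
  by rewrite mulrA bsign_sq mul1r.
by rewrite -LE mul1r.
Qed.

Lemma plucker_factorization :
  B = (\prod_(i < r.+1 | (0 < i)%N) (b i)^-1) *:
        \big[@gouter F n/1]_(i < r.+1) ginner (cblade F (K i)) B.
Proof.
have ue : uniq (index_enum 'I_r.+1) by exact: index_enum_uniq.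
rewrite {1}(gwedge_divide w_kvec w_diag_neq0 w_offdiag ue (fun i _ => w_gouter i)).
have -> : map j (index_enum 'I_r.+1) = L.
  by rewrite [index_enum _]unlock -enumT map_tnth_enum.
have BL : B \in kvec F n (size (rev L)) by rewrite size_rev size_tuple.
have := contracts_kvec BL (leqnn _); rewrite subnn => /kvec0E ->.
rewrite linearZ_LR /= gouter1r scalerA /gwedge.
rewrite [in X in _ = _ *: X](eq_bigr w) => [|i _]; last exact: ginner_K.
congr (_ *: _); under eq_bigr do rewrite w_diagE invfM.
have eps1 : eps^-1 = eps.
  by rewrite -[LHS]mulr1 -(bsign_sq F [set a in L] [set a in L]) mulKf ?bsign_neq0.
rewrite big_split /= prodr_const card_ord eps1 mulrAC -b0E (bigD1 ord0) //= mulrA.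
rewrite mulfV // mul1r; apply: eq_bigl => i.
by rewrite lt0n.
Qed.

Lemma plucker_coefficient i :
  ginner (grev (gouter (cvec F (j i)) (cblade F (K i)))) B = (b i)%:A /\ b i != 0.
Proof.
split=> //; rewrite gouter_cvec_cblade // grev_cblade.
have sz : size (rev (j i :: K i)) = r.+1 by rewrite size_rev size_jK.
rewrite (ginner_cblade _ Br) ?rev_uniq // ?sz //.
have Bs : B \in kvec F n (size (rev (j i :: K i))) by rewrite sz.
by apply: kvec0E; have := contracts_kvec Bs (leqnn _); rewrite subnn.
Qed.

(** The scalar of the factorization is absorbed in the first vector. *)
Lemma plucker_blade : is_blade r.+1 B.
Proof.
split=> //.
  by apply: contraNneq BL0 => ->; rewrite ffunE.
exists (fun i => if i == ord0 then
    (\prod_(i < r.+1 | (0 < i)%N) (b i)^-1) *: w i else w i) => [i|].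
  by case: ifP => _; rewrite ?memvZ.
rewrite {1}plucker_factorization; set c := (X in X *: _).
rewrite !big_ord_recl /= gouterZl ginner_K; congr (_ *: gouter _ _).
by apply: eq_bigr => i _; exact: ginner_K.
Qed.

End PluckerFactorization.

End OuterProduct.

Theorem mainTheorem1 (R : realType) (n r : nat) (hr2 : (2 <= r)%N)
    (hrn : (r <= n)%N) (B : clifford R n) (hB : B \in kvec R n r)
    (hB0 : B != 0) :
  (is_blade r B <-> plucker r B) /\
  (plucker r B ->
   exists (j : 'I_r -> 'I_n) (K : 'I_r -> (r.-1).-tuple 'I_n) (b : 'I_r -> R),
     [/\ injective j,
         (forall i : 'I_r, uniq (K i)),
         (forall i : 'I_r,
            ginner (grev (gouter (cvec R (j i)) (cblade R (K i)))) B = (b i)%:A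
            /\ b i != 0)
       & B = (\prod_(i < r | (0 < i)%N) (b i)^-1)
               *: \big[@gouter R n/1]_(i < r) ginner (cblade R (K i)) B]).
Proof.
case: r hr2 hrn hB => // r _ _ hB.
have [L uL BL0] : exists2 L : r.+1.-tuple 'I_n, uniq L & B [set a in L] != 0.
  (* L enumerates the index set of a nonzero coefficient of B. *)
  have [S BS] : exists S, B S != 0.
    apply/existsP; apply: contraNT hB0; rewrite negb_exists => /forallP B0.
    by apply/eqP/coeff_eq => S; rewrite [RHS]ffunE; apply/eqP/negPn/B0.
  have /kvecP/(_ S BS) cS := hB.
  have szS : size (enum S) == r.+1 by rewrite -cardE cS.
  exists (Tuple szS); first exact: enum_uniq.
  by rewrite (_ : [set a in _] = S) //; apply/setP => a; rewrite inE mem_enum.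
split; first by split; [exact: blade_plucker | move=> pB; exact: plucker_blade pB BL0].
move=> pB; exists (tnth L), (fun i => Tuple (size_complement_word L i)).
exists (fun i => contracts (rev (tnth L i :: complement_word L i)) B set0).
split.
- exact/tuple_uniqP.
- by move=> i; apply: uniq_complement_word.
- by move=> i; apply: plucker_coefficient.
- exact: plucker_factorization.
Qed.
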